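(* Let $G=(V,E)$ be a finite connected simple undirected graph, $uv\notin E$ with $u\ne v$, $s\in V$, and let $S\subseteq V\setminus\{s\}$ be nonempty. Put $B=V\setminus S$, $K_S=(L[B,B])^{-1}$, and, with all vectors restricted to $B$, $$\rho_S=b^{\mathsf T}K_Sb,\quad \eta_S=e_s^{\mathsf T}K_Sa,\quad \alpha_S=e_s^{\mathsf T}K_Sb,\quad \beta_S=b^{\mathsf T}K_Sd,\quad \gamma_S=b^{\mathsf T}K_Sa,$$ $$A_S=\eta_S-\alpha_S\beta_S,\qquad B_S=\rho_S\eta_S-\alpha_S\gamma_S.$$ Then for every $\lambda\ge0$, $$H_s^\lambda(S)-H_s^0(S)=\frac{\lambda(A_S+\lambda B_S)}{1+\lambda\rho_S}.$$ If the restriction of $b$ to $B$ is zero, then $H_s^\lambda(S)-H_s^0(S)=0$.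
   Context: $G_\lambda$ denotes the weighted graph obtained from $G$ by giving every edge of $G$ conductance $1$ and adding the edge $uv$ with conductance $\lambda\ge 0$; the random walk on $G_\lambda$ moves from a vertex along an incident edge with probability proportional to its conductance. $H_s^\lambda(S)=\mathbb E_s\inf\{t\ge0:X_t\in S\}$ is the expected hitting time of $S$ for this walk started at $s$ ($\lambda=0$ is simple random walk on $G$). $L=D-A$ is the graph Laplacian of $G$, $L[B,B]$ its principal submatrix on $B$ (invertible when $S=V\setminus B$ is nonempty), $d$ is the vector of degrees in $G$, $e_x$ is the standard basis vector at $x$, $a=e_u+e_v$, $b=e_u-e_v$. *)

(* Defs.v *)
From HB Require Import structures.
From mathcomp Require Import all_boot all_order all_algebra.
From mathcomp Require Import all_classical all_reals all_analysis.

Set Implicit Arguments.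
Unset Strict Implicit.
Unset Printing Implicit Defensive.
Import Order.TTheory GRing.Theory Num.Theory.
Local Open Scope ring_scope.

Section WeightedGraph.
Variables (R : realType) (V : finType).

Definition simple_graph (e : rel V) := symmetric e /\ irreflexive e.

Definition connected_graph (e : rel V) := forall x y, connect e x y.

(* Conductance of the pair xy in the graph obtained from e by giving conductance
   1 to every edge and adding the edge uv with conductance lam. *)
Definition conductance (e : rel V) (u v : V) (lam : R) (x y : V) : R :=
  (e x y)%:R +
  lam * ((x == u) && (y == v) || (x == v) && (y == u))%:R.

Definition transition (c : V -> V -> R) (x y : V) : R :=
  c x y / \sum_z c x z.

End WeightedGraph.

Section RandomWalk.
Context (R : realType) (V : finType) (d : measure_display)
  (Omega : measurableType d) (P : probability Omega R).
Local Open Scope ereal_scope.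
Local Open Scope classical_set_scope.

(* Paths x : nat -> V only matter here through x 0, ..., x n. *)
Definition follows (X : nat -> Omega -> V) (x : nat -> V) (n : nat) :
  set Omega := [set w | forall t, (t <= n)%N -> X t w = x t].

(* Walk with conductances c started at s. The Markov property is stated in
   product form, so that no event of probability zero is conditioned upon. *)
Record random_walk (c : V -> V -> R) (s : V) (X : nat -> Omega -> V) : Prop :=
  RandomWalk {
    walk_measurable : forall t y, measurable [set w | X t w = y];
    walk_start : P [set w | X 0%N w = s] = 1;
    walk_step : forall (x : nat -> V) (n : nat),
      P (follows X x n.+1) =
      P (follows X x n) * (transition c (x n) (x n.+1))%:E
  }.

(* First time t >= 0 at which X is in S; it is +oo if there is no such time,
   since the infimum of the empty set is +oo. *)
Definition hitting_time (X : nat -> Omega -> V) (S : {set V}) (w : Omega) :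
  \bar R := ereal_inf [set t%:R%:E | t in [set t : nat | X t w \in S]].

Definition expected_hitting_time (X : nat -> Omega -> V) (S : {set V}) :
  \bar R := \int[P]_w hitting_time X S w.

End RandomWalk.

Section LaplacianQuantities.
Variables (R : realType) (V : finType).

Definition degree (e : rel V) (x : V) : R := #|[set y | e x y]|%:R.

Definition laplacian (e : rel V) (x y : V) : R :=
  degree e x * (x == y)%:R - (e x y)%:R.

Definition std_basis (x : V) : V -> R := fun y => (y == x)%:R.

(* Rows and columns indexed by V, or by a subset B of V, are handled through the
   enumeration of B by 'I_#|B|. *)
Definition principal_submx (B : {set V}) (M : V -> V -> R) : 'M[R]_#|B| :=
  \matrix_(i, j) M (enum_val i) (enum_val j).

Definition restrict_vec (B : {set V}) (f : V -> R) : 'cV[R]_#|B| :=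
  \col_i f (enum_val i).

Definition Kmx (e : rel V) (S : {set V}) : 'M[R]_#|~: S| :=
  invmx (principal_submx (~: S) (laplacian e)).

Definition Kform (e : rel V) (S : {set V}) (f g : V -> R) : R :=
  ((restrict_vec (~: S) f)^T *m Kmx e S *m restrict_vec (~: S) g) ord0 ord0.

Definition avec (u v : V) : V -> R := fun x => std_basis u x + std_basis v x.
Definition bvec (u v : V) : V -> R := fun x => std_basis u x - std_basis v x.

Variables (e : rel V) (u v s : V) (S : {set V}).

Definition rhoS : R := Kform e S (bvec u v) (bvec u v).
Definition etaS : R := Kform e S (std_basis s) (avec u v).
Definition alphaS : R := Kform e S (std_basis s) (bvec u v).
Definition betaS : R := Kform e S (bvec u v) (degree e).
Definition gammaS : R := Kform e S (bvec u v) (avec u v).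

Definition AS : R := etaS - alphaS * betaS.
Definition BS : R := rhoS * etaS - alphaS * gammaS.

End LaplacianQuantities.

(* Main.v *)
(* Any h with h = 0 on S and h = 1 + p h off S satisfies
   h(s) = \sum_(m < N) P(T > m) + (Q^N h)(s), where Q is the transition operator
   killed on S. Since |Q^N h|(s) <= C P(T > N), the series converges, hence its
   terms and the remainder vanish in the limit, and E[T] = h(s). Such an h solves
   (L + lam b b^T) h = d + lam a off S, and the Sherman-Morrison formula writes it
   in terms of K_S, which exists and is nonnegative because the Dirichlet energy
   is definite on functions vanishing on S. *)
Require Import Defs.
From mathcomp Require Import all_boot all_order all_algebra.
From mathcomp Require Import all_classical all_reals all_analysis.
From mathcomp Require Import ring.
Import Order.TTheory GRing.Theory Num.Theory.
Import numFieldNormedType.Exports.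
Local Open Scope ring_scope.

(** * The walk killed on S and the series of its survival probabilities *)

Section KilledWalk.
Set Implicit Arguments.
Unset Strict Implicit.
Context {R : realType} {V : finType} (S : {set V}) (p : V -> V -> R).

Definition killed (f : V -> R) (x : V) : R :=
  if x \in S then 0 else \sum_y p x y * f y.

(** For a transition kernel [p] this is the probability, from a given start, of avoiding S at all
    times 0, ..., m. Time 0 counts, since the iteration starts from the indicator of the complement
    of S. *)
Definition survival (m : nat) : V -> R :=
  iter m killed (fun x => (x \notin S)%:R).

Variable h : V -> R.
Hypothesis h_target : forall x, x \in S -> h x = 0.
Hypothesis h_step : forall x, x \notin S -> h x = 1 + \sum_y p x y * h y.

(** The hypotheses say that h is the indicator of the complement of S plus [killed h]; this identity
    is unfolded N times. *)
Lemma sum_survival (N : nat) (x : V) :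
  h x = \sum_(m < N) survival m x + iter N killed h x.
Proof.
elim: N x => [|N IH] x; first by rewrite big_ord0 add0r.
rewrite big_ord_recl /survival /= /killed; case: (boolP (x \in S)) => xS /=.
  by rewrite h_target// big1 ?addr0.
rewrite h_step// -addrA; congr (_ + _).
rewrite (exchange_big _ _ _ _ _ _) /= -big_split /=.
by apply: eq_bigr => y _; rewrite {1}(IH y) mulrDr mulr_sumr.
Qed.

Hypothesis p_ge0 : forall x y, 0 <= p x y.

Lemma survival_ge0 (m : nat) (x : V) : 0 <= survival m x.
Proof.
elim: m x => [|m IH] x; first exact: ler0n.
rewrite /survival /= /killed; case: ifP => // _; apply: sumr_ge0 => y _.
by apply: mulr_ge0 (IH y).
Qed.

(** Since h vanishes on S, its absolute value is at most C times the function that starts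
    [survival], and [killed] preserves such bounds because p is nonnegative. *)
Lemma iter_killed_le (C : R) (N : nat) (x : V) :
  (forall y, `|h y| <= C) -> `|iter N killed h x| <= C * survival N x.
Proof.
move=> hC; elim: N x => [|N IH] x /=.
  rewrite /survival /=; case: (boolP (x \in S)) => xS /=.
    by rewrite h_target// normr0 mulr0.
  by rewrite mulr1; exact: hC.
rewrite /survival /= /killed; case: ifP => _; first by rewrite normr0 mulr0.
rewrite mulr_sumr (le_trans (ler_norm_sum _ _ _))//; apply: ler_sum => y _.
by rewrite normrM ger0_norm// mulrCA ler_wpM2l.
Qed.

Local Open Scope classical_set_scope.

Lemma series_survival (s : V) :
  (forall m, survival m s <= 1) -> series (fun m => survival m s) @ \oo --> h s.
Proof.
move=> le1; pose C := \sum_y `|h y|.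
have hC y : `|h y| <= C.
  by rewrite /C (bigD1 y)//= lerDl sumr_ge0.
have C0 : 0 <= C by exact: sumr_ge0.
have sumE N : series (fun m => survival m s) N = h s - iter N killed h s.
  by rewrite /series /= big_mkord (sum_survival N s) addrK.
have cvgS : cvgn (series (fun m => survival m s)).
  apply: nondecreasing_is_cvgn.
    by apply: nondecreasing_series => // n _ _; exact: survival_ge0.
  (* The remainder is at most C * survival N s <= C in absolute value, so h s + C bounds every
     partial sum. *)
  exists (h s + C) => _ [N _ <-]; rewrite sumE lerD2l lerNl.
  have := iter_killed_le N s hC; rewrite ler_norml => /andP[+ _]; apply: le_trans.
  by rewrite lerN2 ler_piMr.
have surv0 := cvg_series_cvg_0 cvgS.
have tail0 : (iter N killed h s) @[N --> \oo] --> (0 : R).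
  apply/norm_cvg0P.
  apply: (@squeeze_cvgr _ _ _ _ (cst 0) (fun N => C * survival N s)).
  - by near=> N; rewrite normr_ge0 iter_killed_le.
  - exact: cvg_cst.
  - by rewrite -[X in _ --> X](mulr0 C); exact: cvgMl_tmp.
rewrite (_ : series _ = (fun N => h s - iter N killed h s)); last exact/funext.
by rewrite -[X in _ --> X]subr0; apply: cvgB => //; exact: cvg_cst.
Unshelve. all: by end_near. Qed.

End KilledWalk.

(** * From the random walk to the survival series *)

Section ExpectedHittingTime.
Set Implicit Arguments.
Unset Strict Implicit.
Context {R : realType} {V : finType} {d : measure_display}
  {Omega : measurableType d} (P : probability Omega R).
Context (c : V -> V -> R) (s : V) (X : nat -> Omega -> V) (S : {set V}).
Hypothesis walkX : random_walk P c s X.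
Local Open Scope classical_set_scope.
Local Open Scope ereal_scope.

(** The window starts at an arbitrary time n so that an induction on m can shift it; [avoids 0 m] is
    the event that the hitting time exceeds m. *)
Definition avoids (n m : nat) : set Omega :=
  [set w | forall t, (n <= t <= n + m)%N -> X t w \notin S].

Lemma measurable_follows (x : nat -> V) (n : nat) : measurable (follows X x n).
Proof.
rewrite (_ : follows X x n =
    \bigcap_(t in [set t | (t <= n)%N]) [set w | X t w = x t]).
  by apply: bigcap_measurableType => t _; exact: walk_measurable walkX _ _.
by apply/seteqP; split.
Qed.

Lemma measurable_avoids (n m : nat) : measurable (avoids n m).
Proof.
rewrite (_ : avoids n m = \bigcap_(t in [set t | (n <= t <= n + m)%N])
    \bigcup_(y in [set y | y \notin S]) [set w | X t w = y]).
  apply: bigcap_measurableType => t _; apply: fin_bigcup_measurable => [|y _].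
    exact: finite_finset.
  exact: walk_measurable walkX _ _.
apply/seteqP; split => w wn t /wn.
  by exists (X t w).
by case=> y /= yS ->.
Qed.

Lemma prob_split (A : set Omega) (n : nat) : measurable A ->
  P A = \sum_y P (A `&` [set w | X n w = y]).
Proof.
move=> mA.
rewrite {1}(_ : A = \bigcup_(y in [set: V]) (A `&` [set w | X n w = y])); last first.
  by apply/seteqP; split => [w Aw|w [y _ []]//]; exists (X n w).
rewrite measure_fin_bigcup//; last 3 first.
- exact: finite_finset.
- by move=> y z _ _ [w [[_ /= <-] [_ /= <-]]].
- by move=> y _; apply: measurableI => //; exact: walk_measurable walkX _ _.
rewrite [RHS]bigfs ?index_enum_uniq//; last by move=> y _; rewrite mem_index_enum.
by apply: eq_fsbigl; apply/seteqP; split.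
Qed.

Let upd (x : nat -> V) (n : nat) (y : V) (t : nat) :=
  if (t <= n)%N then x t else y.

Lemma follows_upd x n y :
  follows X x n `&` [set w | X n.+1 w = y] = follows X (upd x n y) n.+1.
Proof.
apply/seteqP; split => w /=.
  move=> [xw yw] t; rewrite leq_eqVlt ltnS => /orP[/eqP->|tn].
    by rewrite /upd ltnn.
  by rewrite /upd tn xw.
move=> xw; split => [t tn|]; last by rewrite xw// /upd ltnn.
by rewrite xw ?(leq_trans tn)// /upd tn.
Qed.

Lemma prob_follows_upd x n y :
  P (follows X (upd x n y) n.+1) = P (follows X x n) * (transition c (x n) y)%:E.
Proof.
rewrite (walk_step walkX) {2 3}/upd leqnn ltnn; congr (P _ * _).
by apply/seteqP; split => w xw t tn; rewrite xw// /upd tn.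
Qed.

(** Markov property over m steps, again as a product so that null paths cause no trouble. The
    induction on m splits by the position at time n + 1 and applies to the path extended by it. *)
Lemma prob_follows_avoids (m n : nat) (x : nat -> V) :
  P (follows X x n `&` avoids n m) =
  P (follows X x n) * (survival S (transition c) m (x n))%:E.
Proof.
elim: m n x => [|m IH] n x.
  rewrite /survival /=; case: (boolP (x n \in S)) => xS /=.
    rewrite mule0 (_ : _ `&` _ = set0) ?measure0// -subset0 => w [xw].
    by move=> /(_ n); rewrite addn0 leqnn xw// xS => /(_ isT).
  rewrite mule1; congr (P _); apply: setIidl => w xw t /=.
  by rewrite addn0 -eqn_leq => /eqP <-; rewrite xw.
rewrite /survival /= /killed; case: (boolP (x n \in S)) => xS.
  rewrite mule0 (_ : _ `&` _ = set0) ?measure0// -subset0 => w [xw].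
  by move=> /(_ n); rewrite leqnn leq_addr xw// xS => /(_ isT).
(* The path already puts the walk outside S at time n, so the window may start one step later; both
   windows end at n + m + 1. *)
have -> : follows X x n `&` avoids n m.+1 = follows X x n `&` avoids n.+1 m.
  apply/seteqP; split => w [xw aw]; split => // t /andP[nt tm].
    by apply: aw; rewrite ltnW// addnS -addSn.
  move: nt; rewrite leq_eqVlt => /orP[/eqP<-|nt]; first by rewrite xw.
  by apply: aw; rewrite nt addSn -addnS.
rewrite (@prob_split _ n.+1); last first.
  exact: measurableI (measurable_follows _ _) (measurable_avoids _ _).
(* Finiteness of this probability lets the sum over y be computed in R, where the common factor
   comes out. *)
have finP := fin_num_measure P _ (measurable_follows x n).
under eq_bigr => y _.
  rewrite setIAC follows_upd IH prob_follows_upd -muleA -EFinM /upd ltnn.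
  rewrite -(fineK finP) -EFinM; over.
by rewrite sumEFin -mulr_sumr EFinM fineK.
Qed.

Lemma prob_avoids (m : nat) :
  P (avoids 0 m) = (survival S (transition c) m s)%:E.
Proof.
have startE : follows X (cst s) 0 = [set w | X 0%N w = s].
  by apply/seteqP; split => w /= xw; [exact: xw|case].
have mB := measurable_follows (cst s) 0.
have mA := measurable_avoids 0 m.
have PB : P (follows X (cst s) 0) = 1 by rewrite startE; exact: walk_start walkX.
have := prob_follows_avoids m 0 (cst s).
rewrite PB mul1e => <-; apply/eqP; rewrite eq_le; apply/andP; split; last first.
  by apply: le_measure; rewrite ?inE//; exact: measurableI.
(* The walk starts at s only almost surely: the complement of that event is added as a null set. *)
rewrite -[leRHS]adde0.
have <- : P (~` follows X (cst s) 0) = 0.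
  by rewrite probability_setC// PB subee.
apply: le_trans (measureU2 P _ _); last 2 first.
- exact: measurableI.
- exact: measurableC.
apply: le_measure; rewrite ?inE//.
  by apply: measurableU; [exact: measurableI|exact: measurableC].
move=> w aw; have [bw|bw] := pselect (follows X (cst s) 0 w); first by left.
by right.
Qed.

(** A time T with values in the natural numbers or +oo is the sum over n of the indicators of T >
    n. *)
Lemma hitting_time_series (w : Omega) :
  hitting_time R X S w = \sum_(0 <= n <oo) (\1_(avoids 0 n) w)%:E.
Proof.
rewrite /hitting_time.
have [[t0 ht0]|nohit] := pselect (exists t, X t w \in S); last first.
  rewrite (_ : [set _ | t in _] = set0); last first.
    by rewrite -subset0 => _ [t /= tS _]; apply: nohit; exists t.
  rewrite ereal_inf0; apply/esym/eqyP => A A0.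
  (* Without a hit every term is 1, so the partial sum with [Num.bound A] terms exceeds A. *)
  apply: le_trans (nneseries_lim_ge (Num.bound A) _); last first.
    by move=> n _ _; rewrite lee_fin.
  rewrite (eq_bigr (fun=> 1%:E)); last first.
    move=> n _; rewrite indicE mem_set// => t _; apply/negP => tS.
    by apply: nohit; exists t.
  rewrite sumEFin big_mkord sumr_const card_ord lee_fin.
  by rewrite ltW// archi_boundP// ltW.
have [k kS kmin] := ex_minnP (ex_intro (fun t => X t w \in S) t0 ht0).
(* With first hit k, the terms of index n < k are 1 and those with n >= k are 0, since then k lies
   in the window. *)
rewrite (@nneseries_split _ _ 0 k); last by move=> n _; rewrite lee_fin.
rewrite add0n [X in _ + X]eseries0 ?adde0; last first.
  move=> n kn _; rewrite indicE memNset// => /(_ k); rewrite leq0n /= => /(_ kn).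
  by rewrite kS.
rewrite (eq_big_nat _ _ (F2 := fun=> 1%:E)); last first.
  move=> n /andP[_ nk]; rewrite indicE mem_set// => t /=.
  rewrite add0n => /leq_ltn_trans /(_ nk) tk.
  by apply/negP => /kmin; rewrite leqNgt tk.
rewrite sumEFin big_mkord sumr_const card_ord.
apply/eqP; rewrite eq_le; apply/andP; split.
  by apply: ereal_inf_lbound; exists k.
by apply: le_ereal_inf_tmp => _ [t /= tS <-]; rewrite lee_fin ler_nat kmin.
Qed.

Hypothesis p_ge0 : forall x y, (0 <= transition c x y)%R.

Lemma expected_hitting_time_harmonic (h : V -> R) :
  (forall x, x \in S -> h x = 0%R) ->
  (forall x, x \notin S -> h x = (1 + \sum_y transition c x y * h y)%R) ->
  expected_hitting_time P X S = (h s)%:E.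
Proof.
move=> h0 h1; rewrite /expected_hitting_time.
under eq_integral do rewrite hitting_time_series.
(* The terms are nonnegative and measurable, so the series is integrated term by term. *)
rewrite integral_nneseries//=; last first.
  move=> n; apply/measurable_realfun.measurable_EFinP.
  exact/measurable_realfun.measurable_indic/measurable_avoids.
rewrite (eq_eseriesr (g := fun n => (survival S (transition c) n s)%:E));
  last first.
  move=> n _; rewrite integral_indic//; last exact: measurable_avoids.
  by rewrite setIT; exact: prob_avoids.
apply: cvg_lim => //.
rewrite (_ : (fun n => _) =
    EFin \o series (fun m => survival S (transition c) m s)); last first.
  by apply/funext => n /=; rewrite sumEFin.
apply: cvg_EFin; first exact: nearW.
apply: series_survival => // m.
rewrite -lee_fin -prob_avoids; apply: probability_le1.
exact: measurable_avoids.
Qed.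

End ExpectedHittingTime.

(** * Vectors indexed by B as functions on V vanishing outside B *)

Section ZeroExtension.
Set Implicit Arguments.
Unset Strict Implicit.
Context {R : realType} {V : finType} (B : {set V}).

(** A sum over indices avoids inverting the enumeration of B, which would require a proof that x
    lies in B. *)
Definition zero_extension (g : 'cV[R]_#|B|) (x : V) : R :=
  \sum_i (enum_val i == x)%:R * g i ord0.

Lemma zero_extension_out (g : 'cV[R]_#|B|) (x : V) :
  x \notin B -> zero_extension g x = 0.
Proof.
move=> xB; rewrite /zero_extension big1// => i _.
case: eqP => [xE|_]; last by rewrite mul0r.
by move: xB; rewrite -xE enum_valP.
Qed.

Lemma sum_zero_extension (g : 'cV[R]_#|B|) (F : V -> R) :
  \sum_x F x * zero_extension g x = \sum_i F (enum_val i) * g i ord0.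
Proof.
under eq_bigr do rewrite mulr_sumr.
rewrite exchange_big; apply: eq_bigr => i _.
rewrite (bigD1 (enum_val i))//= eqxx mul1r big1 ?addr0// => x /negPf xi.
by rewrite eq_sym xi mul0r mulr0.
Qed.

Lemma zero_extension_val (g : 'cV[R]_#|B|) (i : 'I_#|B|) :
  zero_extension g (enum_val i) = g i ord0.
Proof.
rewrite /zero_extension (bigD1 i)//= eqxx mul1r big1 ?addr0// => j /negPf ji.
by rewrite (inj_eq enum_val_inj) ji mul0r.
Qed.

End ZeroExtension.

(** * Dirichlet energy, and the Laplacian with Dirichlet condition on S *)

Section GroundedLaplacian.
Set Implicit Arguments.
Unset Strict Implicit.
Context {R : realType} {V : finType} (e : rel V).
Hypothesis e_sym : symmetric e.

Lemma degreeE (x : V) : degree R e x = \sum_y (e x y)%:R.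
Proof.
rewrite /degree -sum1dep_card natr_sum big_mkcond.
by apply: eq_bigr => y _; case: (e x y).
Qed.

Lemma laplacianE (f : V -> R) (x : V) :
  \sum_y laplacian R e x y * f y = degree R e x * f x - \sum_y (e x y)%:R * f y.
Proof.
under eq_bigr do rewrite /laplacian mulrBl.
rewrite sumrB (bigD1 x)//= eqxx mulr1 big1 ?addr0// => y /negPf yx.
by rewrite eq_sym yx mulr0 mul0r.
Qed.

(** Expanding the left side gives E; exchanging x and y gives E again by symmetry of e, and the two
    expressions add up to the sum of squares. *)
Lemma dirichlet_energy (f : V -> R) :
  \sum_x f x * (\sum_y laplacian R e x y * f y) =
  2^-1 * \sum_x \sum_y (e x y)%:R * (f x - f y) ^+ 2.
Proof.
pose E := \sum_x \sum_y (e x y)%:R * (f x ^+ 2 - f x * f y).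
have -> : \sum_x f x * (\sum_y laplacian R e x y * f y) = E.
  apply: eq_bigr => x _; rewrite laplacianE degreeE mulr_suml -sumrB mulr_sumr.
  by apply: eq_bigr => y _; ring.
have EC : E = \sum_x \sum_y (e x y)%:R * (f y ^+ 2 - f x * f y).
  rewrite /E exchange_big; apply: eq_bigr => x _; apply: eq_bigr => y _.
  by rewrite e_sym [f y * _]mulrC.
suff -> : \sum_x \sum_y (e x y)%:R * (f x - f y) ^+ 2 = E + E by field.
rewrite {2}EC -big_split; apply: eq_bigr => x _; rewrite -big_split.
by apply: eq_bigr => y _ /=; ring.
Qed.

Lemma dirichlet_energy_ge0 (f : V -> R) :
  0 <= \sum_x f x * (\sum_y laplacian R e x y * f y).
Proof.
rewrite dirichlet_energy mulr_ge0 ?invr_ge0//.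
by apply: sumr_ge0 => x _; apply: sumr_ge0 => y _; rewrite mulr_ge0 ?sqr_ge0.
Qed.

Hypothesis e_conn : connected_graph e.

(** Each squared difference along an edge must vanish, and paths carry the equality to all pairs. *)
Lemma dirichlet_energy_eq0 (f : V -> R) :
  \sum_x f x * (\sum_y laplacian R e x y * f y) = 0 -> forall x y, f x = f y.
Proof.
rewrite dirichlet_energy => /eqP; rewrite mulf_eq0 invr_eq0 pnatr_eq0 /=.
have ge0 x y : 0 <= (e x y)%:R * (f x - f y) ^+ 2 by rewrite mulr_ge0 ?sqr_ge0.
rewrite psumr_eq0 => [/allP E0|x _]; last exact: sumr_ge0.
have edge x y : e x y -> f x = f y.
  move=> exy; have := E0 x (mem_index_enum x).
  rewrite psumr_eq0//= => /allP/(_ y (mem_index_enum y)) /=.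
  by rewrite exy mul1r sqrf_eq0 subr_eq0 => /eqP.
move=> x y; have /connectP[p] := e_conn x y.
elim: p x => [|z p IH] x /=; first by move=> _ ->.
by move=> /andP[/edge -> /IH].
Qed.

Variable S : {set V}.
Hypothesis S_neq0 : S <> finset.set0.

(** A vector of the left kernel, extended by zero, has zero energy, hence is constant; it vanishes
    on the nonempty set S. *)
Lemma grounded_laplacian_unit :
  principal_submx (~: S) (laplacian R e) \in unitmx.
Proof.
rewrite -row_free_unit; apply: inj_row_free => v vL.
pose f := zero_extension v^T.
have [t tS] : exists t, t \in S by apply/finset.set0Pn/eqP.
have f0 x : x \in S -> f x = 0.
  by move=> xS; rewrite /f zero_extension_out// finset.in_setC negbK.
have fL (j : 'I_#|~: S|) : \sum_x laplacian R e x (enum_val j) * f x = 0.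
  rewrite sum_zero_extension; move/rowP/(_ j): vL.
  rewrite !mxE => vLj; rewrite -[RHS]vLj.
  by apply: eq_bigr => i _; rewrite !mxE mulrC.
have /dirichlet_energy_eq0 fC : \sum_x f x * (\sum_y laplacian R e x y * f y) = 0.
  (* Grouped by columns y, the double sum vanishes: f y = 0 on S, and the column sum is zero off
     S. *)
  under eq_bigr do rewrite mulr_sumr.
  rewrite exchange_big big1// => y _ /=; under eq_bigr do rewrite mulrCA mulrA.
  rewrite -mulr_suml; case: (boolP (y \in S)) => yS; first by rewrite f0// mulr0.
  have yB : y \in ~: S by rewrite finset.in_setC.
  by rewrite -(enum_rankK_in yB yB) fL mul0r.
apply/rowP => i; rewrite mxE -(f0 t tS) -(fC (enum_val i) t).
by rewrite /f zero_extension_val mxE.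
Qed.

(** The Green potential of f: it solves L h = f off S with h = 0 on S. *)
Definition potential (f : V -> R) : V -> R :=
  zero_extension (Kmx R e S *m restrict_vec (~: S) f).

Lemma potential_target (f : V -> R) (x : V) : x \in S -> potential f x = 0.
Proof.
by move=> xS; rewrite /potential zero_extension_out// finset.in_setC negbK.
Qed.

Lemma laplacian_potential (f : V -> R) (x : V) : x \notin S ->
  \sum_y laplacian R e x y * potential f y = f x.
Proof.
move=> xS; have xB : x \in ~: S by rewrite finset.in_setC.
rewrite sum_zero_extension -(enum_rankK_in xB xB).
set i := enum_rank_in xB x.
have := congr1 (fun M : 'cV_#|~: S| => M i ord0)
  (mulKVmx grounded_laplacian_unit (restrict_vec (~: S) f)).
rewrite [RHS]mxE => <-; rewrite [RHS]mxE.
by apply: eq_bigr => j _; rewrite [in RHS]mxE.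
Qed.

Lemma Kform_potential (w f : V -> R) :
  Kform e S w f = \sum_x w x * potential f x.
Proof.
rewrite sum_zero_extension /Kform -mulmxA mxE.
by apply: eq_bigr => i _; rewrite !mxE.
Qed.

Lemma KformDr (w f g : V -> R) (k : R) :
  Kform e S w (fun x => f x + k * g x) = Kform e S w f + k * Kform e S w g.
Proof.
rewrite /Kform.
have -> : restrict_vec (~: S) (fun x => f x + k * g x) =
    restrict_vec (~: S) f + k *: restrict_vec (~: S) g.
  by apply/colP => i; rewrite !mxE.
by rewrite mulmxDr -scalemxAr !mxE.
Qed.

(** The form equals the Dirichlet energy of the potential of f. On S, where L h may differ from f,
    the factor h is zero. *)
Lemma Kform_ge0 (f : V -> R) : 0 <= Kform e S f f.
Proof.
rewrite Kform_potential.
rewrite (eq_bigr (fun x =>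
  potential f x * \sum_y laplacian R e x y * potential f y)).
  exact: dirichlet_energy_ge0.
move=> x _; case: (boolP (x \in S)) => xS.
  by rewrite potential_target// mulr0 mul0r.
by rewrite laplacian_potential// mulrC.
Qed.

(** A path from x to a point of S is nontrivial, so it leaves x along an edge. *)
Lemma degree_gt0 (x : V) : x \notin S -> 0 < degree R e x.
Proof.
move=> xS; have [t tS] : exists t, t \in S by apply/finset.set0Pn/eqP.
have /connectP[[|y p] /=] := e_conn x t; first by move=> _ tx; rewrite -tx tS in xS.
case/andP=> exy _ _; rewrite degreeE (bigD1 y)//= exy.
by rewrite ltr_pwDl// sumr_ge0.
Qed.

End GroundedLaplacian.

(** * The edge uv as a rank-one perturbation of the Laplacian *)

Section AddedEdge.
Set Implicit Arguments.
Unset Strict Implicit.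
Context {R : realType} {V : finType} (e : rel V) (u v : V).
Hypothesis uv : u <> v.

Lemma sum_std_basis (w : V) (f : V -> R) : \sum_y std_basis R w y * f y = f w.
Proof.
rewrite (bigD1 w)//= /std_basis eqxx mul1r big1 ?addr0// => y /negPf ->.
by rewrite mul0r.
Qed.

Lemma sum_bvec (f : V -> R) : \sum_y bvec R u v y * f y = f u - f v.
Proof.
under eq_bigr do rewrite /bvec mulrBl.
by rewrite sumrB !sum_std_basis.
Qed.

(** Since u and v differ, the two orientations exclude each other and the disjunction becomes a
    sum. *)
Lemma conductanceE (lam : R) (x y : V) :
  conductance e u v lam x y = (e x y)%:R +
  lam * (std_basis R u x * std_basis R v y + std_basis R v x * std_basis R u y).
Proof.
rewrite /conductance /std_basis; congr (_ + _ * _).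
have [->|xu] := eqVneq x u; have [->|yv] := eqVneq y v; rewrite /= ?eqxx /=;
  case: (eqVneq u v) => [/uv//|_]; rewrite /= ?mulr1 ?mul0r ?mul1r ?addr0 ?add0r//.
all: by case: (x == v); case: (y == u); rewrite /= ?mulr1 ?mul0r ?mulr0.
Qed.

Lemma sum_conductance (lam : R) (x : V) (f : V -> R) :
  \sum_y conductance e u v lam x y * f y = \sum_y (e x y)%:R * f y +
  lam * (std_basis R u x * f v + std_basis R v x * f u).
Proof.
rewrite -(sum_std_basis u) -(sum_std_basis v) !mulr_sumr -!big_split /= mulr_sumr.
rewrite -big_split; apply: eq_bigr => y _ /=.
by rewrite conductanceE; ring.
Qed.

Lemma total_conductance (lam : R) (x : V) :
  \sum_y conductance e u v lam x y = degree R e x + lam * avec R u v x.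
Proof.
have := sum_conductance lam x (fun=> 1).
under eq_bigr do rewrite mulr1.
move=> ->; under eq_bigr do rewrite mulr1.
by rewrite -degreeE /avec !mulr1.
Qed.

(** The Laplacian of the weighted graph is L + lam b b^T, applied here to f with b^T f = f u - f
    v. *)
Lemma laplacian_conductance (lam : R) (x : V) (f : V -> R) :
  (degree R e x + lam * avec R u v x) * f x -
    \sum_y conductance e u v lam x y * f y =
  \sum_y laplacian R e x y * f y + lam * bvec R u v x * (f u - f v).
Proof.
rewrite sum_conductance laplacianE /avec /bvec.
have drop w : std_basis R w x * f x = std_basis R w x * f w.
  by rewrite /std_basis; case: eqP => [->//|_]; rewrite !mul0r.
by rewrite mulrDl -mulrA mulrDl !drop; ring.
Qed.

Hypotheses (e_sym : symmetric e) (e_conn : connected_graph e).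
Variables (s : V) (S : {set V}).
Hypotheses (S_neq0 : S <> finset.set0) (lam : R) (lam_ge0 : 0 <= lam).

(* Sherman-Morrison: [t] is the potential drop [h u - h v], which turns the
   rank-one perturbation of the Laplacian into a right-hand side for [K_S]. *)
Lemma expected_hitting_timeE (d : measure_display) (Omega : measurableType d)
    (P : probability Omega R) (X : nat -> Omega -> V) :
  random_walk P (conductance e u v lam) s X ->
  let t := (betaS R e u v S + lam * gammaS R e u v S) /
           (1 + lam * rhoS R e u v S) in
  expected_hitting_time P X S =
  (Kform e S (std_basis R s) (degree R e) +
   lam * (etaS R e u v s S - t * alphaS R e u v s S))%:E.
Proof.
move=> walkX t.
(* The term lam b (h u - h v) is moved to the right-hand side, with the drop replaced by its
   predicted value t. *)
pose g x := degree R e x + lam * avec R u v x + (- (lam * t)) * bvec R u v x.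
pose h := potential e S g.
have KgE w : Kform e S w g = Kform e S w (degree R e) +
    lam * Kform e S w (avec R u v) - lam * t * Kform e S w (bvec R u v).
  by rewrite /g KformDr KformDr mulNr.
have hE : h s = Kform e S (std_basis R s) g.
  by rewrite Kform_potential sum_std_basis.
have rho_neq0 : 1 + lam * rhoS R e u v S != 0.
  by rewrite gt_eqF// ltr_pwDl// mulr_ge0// /rhoS Kform_ge0.
(* Self-consistency: b^T K_S g = beta + lam gamma - lam t rho, which equals t exactly for the chosen
   t. *)
have dropE : h u - h v = t.
  rewrite -sum_bvec -Kform_potential KgE -/(betaS _ _ _ _ _) -/(gammaS _ _ _ _ _).
  by rewrite -/(rhoS _ _ _ _ _) /t; field.
have total_gt0 x : x \notin S -> 0 < degree R e x + lam * avec R u v x.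
  move=> xS; apply: ltr_pwDl; first exact: degree_gt0 xS.
  by rewrite mulr_ge0// /avec addr_ge0// ler0n.
have -> : Kform e S (std_basis R s) (degree R e) +
    lam * (etaS R e u v s S - t * alphaS R e u v s S) = h s.
  by rewrite hE KgE /etaS /alphaS; ring.
apply: (expected_hitting_time_harmonic walkX) => [x y|x xS|x xS].
- have c_ge0 z : 0 <= conductance e u v lam x z.
    by rewrite /conductance; apply: addr_ge0 => //; exact: mulr_ge0.
  by rewrite /transition divr_ge0// sumr_ge0.
- exact: potential_target.
have := laplacian_conductance lam x h.
rewrite laplacian_potential// dropE /g => eqh.
have Hc := total_gt0 x xS.
have -> : \sum_y transition (conductance e u v lam) x y * h y =
    (\sum_y conductance e u v lam x y * h y) / (degree R e x + lam * avec R u v x).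
  rewrite mulr_suml; apply: eq_bigr => y _.
  by rewrite /transition total_conductance mulrAC.
set H := degree R e x + lam * avec R u v x in eqh Hc *.
(* Multiplying by the positive total conductance turns the one-step equation into the Laplacian
   equation [eqh]. *)
apply: (mulfI (lt0r_neq0 Hc)); rewrite mulrDr mulr1.
rewrite [_ * (_ / _)]mulrC divfK ?lt0r_neq0//.
by apply/eqP; rewrite -subr_eq eqh; apply/eqP; ring.
Qed.

End AddedEdge.

(** * Comparison of the expected hitting times with and without the added edge *)

Theorem theorem4p1 (R : realType) (V : finType) (e : rel V)
  (hsimple : simple_graph e) (hconn : connected_graph e)
  (u v s : V) (huv : u <> v) (hnuv : ~~ e u v)
  (S : {set V}) (hS : S <> finset.set0) (hsS : s \notin S)
  (lam : R) (hlam : 0 <= lam)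
  (d0 : measure_display) (Omega0 : measurableType d0)
  (P0 : probability Omega0 R) (X0 : nat -> Omega0 -> V)
  (hX0 : random_walk P0 (conductance e u v 0) s X0)
  (d1 : measure_display) (Omega1 : measurableType d1)
  (P1 : probability Omega1 R) (X1 : nat -> Omega1 -> V)
  (hX1 : random_walk P1 (conductance e u v lam) s X1) :
  (expected_hitting_time P1 X1 S - expected_hitting_time P0 X0 S =
   (lam * (AS R e u v s S + lam * BS R e u v s S) /
    (1 + lam * rhoS R e u v S))%:E)%E
  /\
  (restrict_vec (~: S) (bvec R u v) = 0 ->
   (expected_hitting_time P1 X1 S - expected_hitting_time P0 X0 S = 0)%E).
Proof.
have [esym _] := hsimple.
have diffE : (expected_hitting_time P1 X1 S - expected_hitting_time P0 X0 S =
   (lam * (AS R e u v s S + lam * BS R e u v s S) /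
    (1 + lam * rhoS R e u v S))%:E)%E.
  rewrite (expected_hitting_timeE huv esym hconn hS hlam hX1).
  rewrite (expected_hitting_timeE huv esym hconn hS (lexx 0) hX0) -EFinB.
  (* The terms e_s^T K_S d cancel, leaving lam (eta - t alpha), and eta (1 + lam rho) - alpha (beta
     + lam gamma) = A_S + lam B_S. *)
  congr (_%:E); rewrite /AS /BS; field.
  by rewrite gt_eqF// ltr_pwDl// mulr_ge0// /rhoS Kform_ge0.
split=> // b0; rewrite diffE.
(* As u and v differ, b is 1 at u and -1 at v; vanishing on B forces both endpoints into S, so a
   vanishes on B too. *)
have uvS w : (w == u) || (w == v) -> w \in S.
  apply: contraLR => wS; have wB : w \in ~: S by rewrite finset.in_setC.
  have := congr1 (fun M : 'cV[R]_#|~: S| => M (enum_rank_in wB w) ord0) b0.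
  rewrite !mxE enum_rankK_in// /bvec /std_basis.
  case: (eqVneq w u) => [->|_]; case: (eqVneq _ v) => //= _.
  - by rewrite subr0 => /eqP; rewrite oner_eq0.
  - by rewrite sub0r => /eqP; rewrite oppr_eq0 oner_eq0.
have a0 : restrict_vec (~: S) (avec R u v) = 0.
  apply/colP => i; rewrite !mxE /avec /std_basis.
  have iS : enum_val i \notin S by have := enum_valP i; rewrite finset.in_setC.
  have := contra (uvS (enum_val i)) iS; rewrite negb_or.
  move=> /andP[/negPf -> /negPf ->].
  by rewrite addr0.
(* Every form with a or b on the right is now zero; beta, whose right vector is d, occurs only
   multiplied by alpha = 0. *)
rewrite /AS /BS /etaS /alphaS /rhoS /gammaS /Kform b0 a0 !mulmx0 !mxE.
by congr (_%:E); ring.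
Qed.
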